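(* Let $b$ be a locally finite graph over $(X,m)$ and let $q=0$. Suppose that the Cheeger constant at infinity $$\alpha_\infty=\sup_{K\subseteq X\text{ finite}}\ \inf_{\emptyset\ne W\subseteq X\setminus K\text{ finite}}\frac{|\partial W|}{\mathrm{vol}(W)}$$ satisfies $\alpha_\infty>0$, and that $D_\infty=\liminf_{x\to\infty}\deg_m(x)=\infty$. Let $\lambda\in\mathbb{R}$ and let $d$ be an intrinsic metric with jump size $1$. Let $u$ be either (a) an approximable function $u\in\mathcal{F}$ that is a solution of $(\mathcal{H}-\lambda)u=0$ or a positive subsolution (i.e. $u\ge0$ and $(\mathcal{H}-\lambda)u\le0$), or (b) a solution $u\in D(H)$ of $(\mathcal{H}-\lambda)u=0$. Then, for a fixed vertex $o\in X$ and for all $R>0$, $$u\in\ell^2(X,e^{Rd(o,\cdot)}\deg),$$ and there is $r=r(\alpha_\infty)>0$ such that $$u\in\ell^2(X,e^{r|\cdot|}\deg),$$ where $|x|$ is the natural graph distance of $x\in X$ to a fixed vertex $o\in X$. Specifically, one can choose $r>0$ such that $r^2\left(\frac{1+e^r}{16}\right)<1-\sqrt{1-\alpha_\infty^2}=:a$, which is for instance satisfied by $r=2ae^{-a}$.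
   Context: $X$ is an infinite countable set, $m:X\to(0,\infty)$, and a graph $b$ over $(X,m)$ is a symmetric function $b:X\times X\to[0,\infty)$ with zero diagonal and $\sum_{y}b(x,y)<\infty$ for all $x$; $x\sim y$ means $b(x,y)>0$; the graph is locally finite if $\#\{y:y\sim x\}<\infty$ for all $x$. The natural (combinatorial) graph distance of two vertices is the smallest $n$ for which there is a path $x_0\sim\ldots\sim x_n$ joining them. Since $q=0$: $\deg(x)=\sum_yb(x,y)$, $\deg_m(x)=\deg(x)/m(x)$, $\mathrm{vol}(W)=\sum_{x\in W}\deg(x)$ and $|\partial W|=\sum_{(x,y)\in W\times(X\setminus W)}b(x,y)$ for finite $W\subseteq X$. In $D_\infty$, $\infty$ is the additional point of the one-point compactification of the discrete space $X$, so $D_\infty=\infty$ means that for every $n$ one has $\deg_m\ge n$ outside some finite set. $C(X)$ is the space of real functions on $X$, $C_c(X)$ those with finite support. For $f\in C(X)$, $|\nabla f|^2(x)=\frac{1}{2m(x)}\sum_{y}b(x,y)(f(x)-f(y))^2$. $h(\varphi)=\sum_{X}|\nabla\varphi|^2m$ for $\varphi\in C_c(X)$; $h$ is closable in $\ell^2(X,m)$, and $H$ is the self-adjoint operator on $\ell^2(X,m)$ associated with its closure, with domain $D(H)$. $H$ is a restriction of the formal operator $\mathcal{H}f(x)=\frac1{m(x)}\sum_y b(x,y)(f(x)-f(y))$, defined on $\mathcal{F}=\{f\in C(X):\sum_y b(x,y)|f(y)|<\infty\ \forall x\in X\}$. A function $u\in\mathcal{F}$ is approximable if there is a sequence $(\varphi_n)$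 in $C_c(X)$ with $0\le\varphi_n\nearrow1$ pointwise and $\lim_{n\to\infty}\sum_Xu^2|\nabla\varphi_n|^2m=0$. An intrinsic metric is a pseudo-metric $d:X\times X\to[0,\infty)$ (symmetric, zero on the diagonal, triangle inequality) with $\sum_yb(x,y)d(x,y)^2\le m(x)$ for all $x$; its jump size is $\sup\{d(x,y):b(x,y)>0\}$. For a weight $\mu\ge0$, $u\in\ell^2(X,\mu)$ means $\sum_Xu^2\mu<\infty$. *)

(* Defs.v *)
From HB Require Import structures.
From mathcomp Require Import all_boot all_order all_algebra.
From mathcomp Require Import all_classical all_reals all_analysis.

Set Implicit Arguments.
Unset Strict Implicit.
Unset Printing Implicit Defensive.

Import Order.TTheory GRing.Theory Num.Theory.
Import numFieldNormedType.Exports.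

Local Open Scope classical_set_scope.
Local Open Scope ring_scope.

Section graphs.
Variables (R : realType) (X : countType).
Implicit Types (m mu u v w f : X -> R) (b d : X -> X -> R).

(* Value of an absolutely convergent sum over X of terms of arbitrary sign. *)
Definition usum f : R :=
  fine (\esum_(x in [set: X]) (f^\+ x)%:E)
  - fine (\esum_(x in [set: X]) (f^\- x)%:E).

Record is_graph b : Prop := IsGraph {
  graph_ge0 : forall x y, 0 <= b x y ;
  graph_sym : forall x y, b x y = b y x ;
  graph_diag : forall x, b x x = 0 ;
  graph_summable : forall x, (\esum_(y in [set: X]) (b x y)%:E < +oo)%E }.

Definition adj b : rel X := fun x y => 0 < b x y.

Definition locally_finite b : Prop := forall x, finite_set [set y | adj b y x].

Definition walk b (x y : X) (n : nat) : Prop :=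
  exists p : seq X, [/\ path (adj b) x p, last x p = y & size p = n].

(* Connectedness of the graph is not assumed: the distance between vertices
   that are not joined by any path is set to 0. *)
Definition gdist b (x y : X) : nat :=
  if pselect (exists n, `[< walk b x y n >]) is left e then ex_minn e else 0%N.

Definition deg b (x : X) : R := fine (\esum_(y in [set: X]) (b x y)%:E).

Definition degm m b (x : X) : R := deg b x / m x.

Definition vol b (W : set X) : R := \sum_(x \in W) deg b x.

Definition bdry b (W : set X) : R :=
  fine (\esum_(z in W `*` ~` W) (b z.1 z.2)%:E).

(* All ratios lie in [0, 1], with value 0 when vol W = 0, and on an infinite X
   the sets below are nonempty, so these sup and inf are the actual ones. *)
Definition cheeger_inf b : R :=
  sup [set inf [set bdry b W / vol b W | W in
                  [set W | [/\ finite_set W, W !=set0 & W `<=` ~` K]]]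
      | K in [set K : set X | finite_set K]].

(* liminf of degm at the point at infinity of the one-point compactification of
   the discrete space X, whose neighbourhoods trace the cofinite sets on X. *)
Definition D_inf m b : \bar R :=
  ereal_sup [set ereal_inf [set (degm m b x)%:E | x in ~` K]
            | K in [set K : set X | finite_set K]].

Definition l2 mu u : Prop :=
  (\esum_(x in [set: X]) ((u x) ^+ 2 * mu x)%:E < +oo)%E.

Definition Cc f : Prop := finite_set [set x | f x != 0].

(* Squared length |nabla f|^2 of the gradient at x. *)
Definition gradsq m b f (x : X) : \bar R :=
  (((2 * m x)^-1)%:E * \esum_(y in [set: X]) (b x y * (f x - f y) ^+ 2)%:E)%E.

(* h on C_c(X) as a quadratic form, and its polarization. *)
Definition hquad m b f : R :=
  fine (\esum_(x in [set: X]) (gradsq m b f x * (m x)%:E)%E).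

Definition hform m b f (g : X -> R) : R :=
  (hquad m b (f \+ g) - hquad m b (f \- g)) / 4.

(* phi is a sequence in C_c(X) converging to u in l^2(X, m) and Cauchy with
   respect to h. *)
Definition form_approx m b (phi : nat -> X -> R) u : Prop :=
  [/\ forall n, Cc (phi n),
      (fun n => \esum_(x in [set: X]) ((phi n x - u x) ^+ 2 * m x)%:E)
        @ \oo --> 0%E
    & forall e : R, 0 < e -> exists N : nat, forall i j : nat,
        (N <= i)%N -> (N <= j)%N -> hquad m b (phi i \- phi j) < e].

(* Domain of the closure of h, and the closure as a relation: [hbar m b u w c]
   means that u and w have the (well-defined, h being closable) form value c. *)
Definition hbar_dom m b u : Prop :=
  l2 m u /\ exists phi, form_approx m b phi u.

Definition hbar m b u w (c : R) : Prop :=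
  exists phi psi : nat -> X -> R,
    [/\ form_approx m b phi u, form_approx m b psi w
      & (fun n => hform m b (phi n) (psi n)) @ \oo --> c].

(* Graph of the self-adjoint operator H associated with the closure of h:
   u is in D(H) with H u = v. *)
Definition opH m b u v : Prop :=
  [/\ hbar_dom m b u, l2 m v
    & forall w, hbar_dom m b w ->
        hbar m b u w (usum (fun x => v x * w x * m x))].

Definition domH m b u : Prop := exists v, opH m b u v.

Definition calF b u : Prop :=
  forall x, (\esum_(y in [set: X]) (b x y * `|u y|)%:E < +oo)%E.

Definition calH m b u (x : X) : R :=
  (m x)^-1 * usum (fun y => b x y * (u x - u y)).

Definition solution m b (lambda : R) u : Prop :=
  forall x, calH m b u x - lambda * u x = 0.

Definition positive_subsolution m b (lambda : R) u : Prop :=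
  (forall x, 0 <= u x) /\ (forall x, calH m b u x - lambda * u x <= 0).

Definition approximable m b u : Prop :=
  exists phi : nat -> X -> R,
    [/\ forall n, Cc (phi n),
        forall n x, 0 <= phi n x,
        forall x, {homo phi ^~ x : i j / (i <= j)%N >-> i <= j},
        forall x, phi ^~ x @ \oo --> (1 : R)
      & (fun n => \esum_(x in [set: X])
           (((u x) ^+ 2)%:E * gradsq m b (phi n) x * (m x)%:E)%E)
          @ \oo --> 0%E].

Record intrinsic_metric m b d : Prop := IntrinsicMetric {
  intrinsic_ge0 : forall x y, 0 <= d x y ;
  intrinsic_diag : forall x, d x x = 0 ;
  intrinsic_sym : forall x y, d x y = d y x ;
  intrinsic_triangle : forall x y z, d x z <= d x y + d y z ;
  intrinsic_le : forall x,
    (\esum_(y in [set: X]) (b x y * (d x y) ^+ 2)%:E <= (m x)%:E)%E }.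

Definition jump_size b d : \bar R :=
  ereal_sup [set (d z.1 z.2)%:E | z in [set z : X * X | 0 < b z.1 z.2]].

Definition cheeger_gap (alpha : R) : R := 1 - Num.sqrt (1 - alpha ^+ 2).

Definition admissible_rate (alpha r : R) : Prop :=
  0 < r /\ r ^+ 2 * ((1 + expR r) / 16) < cheeger_gap alpha.

End graphs.

(* Main.v *)
Require Import Defs.
From mathcomp Require Import all_boot all_order all_algebra.
From mathcomp Require Import all_classical all_reals all_analysis.
From mathcomp Require Import finmap ring lra.

Import Order.TTheory GRing.Theory Num.Theory.
Import numFieldNormedType.Exports.

Local Open Scope classical_set_scope.
Local Open Scope ring_scope.

(** By the Cheeger inequality, a * sum deg psi^2 <= h(psi) for every
    a < 1 - sqrt(1 - alpha^2) and every finitely supported psi vanishing on a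
    suitable finite set K, and D_oo = oo makes lambda m negligible against deg
    off K.  Apply this to psi = u phi with phi = f chi, where f is a truncated
    exponential weight set to 0 on K and chi is a cutoff:
      h(u phi) = sum_x u (H u) phi^2 m
                 + 1/2 sum_{x,y} b(x,y) u(x) u(y) (phi(x) - phi(y))^2.
    The first sum is at most lambda sum u^2 phi^2 m.  In the second one,
    (e^p - e^q)^2 <= |p - q|^2 e^|p - q| e^p e^q bounds the contribution of the
    weight by c sum deg (u phi)^2, with c < a; the edges meeting K contribute a
    constant, and the gradient of chi tends to 0.  What is left bounds
    sum deg (u f)^2 uniformly in the truncation.  For the graph distance
    c = r^2 e^(r/2) / 8 <= r^2 (1 + e^r) / 16; for an intrinsic metric c is
    arbitrarily small by D_oo = oo.  In case (b), the Cheeger inequality embeds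
    the form domain into l^2(X, deg), and there indicators of finite sets are
    cutoffs with small gradient energy. *)

(** * Infinite sums of nonnegative terms as sums over duplicate-free lists *)

Section list_sums.
Context {R : realType} {X : choiceType}.

Lemma sum_le_esum (r : seq X) (f : X -> R) : uniq r -> (forall x, 0 <= f x) ->
  ((\sum_(x <- r) f x)%:E <= \esum_(x in [set: X]) (f x)%:E)%E.
Proof.
move=> ur f0; apply: esum_ge; exists [set` r]; first by split => //; exact: finite_seq.
by rewrite -fsbig_seq// sumEFin.
Qed.

Lemma esum_le_of_sum (f : X -> R) (C : R) :
  (forall r, uniq r -> \sum_(x <- r) f x <= C) ->
  (\esum_(x in [set: X]) (f x)%:E <= C%:E)%E.
Proof.
move=> H; apply: ge_ereal_sup => _ [A [fA _] <-].
by rewrite fsbig_finite// sumEFin lee_fin H// fset_uniq.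
Qed.

(** This lets the enumerating list be changed whenever the support is controlled, so that sums over
    X, over neighbours and over large finite lists can be compared. *)
Lemma sum_le_sum_support (r s : seq X) (f : X -> R) :
  uniq r -> uniq s -> (forall x, 0 <= f x) ->
  (forall x, x \in r -> f x != 0 -> x \in s) ->
  \sum_(x <- r) f x <= \sum_(x <- s) f x.
Proof.
move=> ur us f0 H; rewrite (bigID (mem s))/= [X in _ + X]big1_seq ?addr0; last first.
  by move=> x /andP[xs xr]; apply: contraNeq xs => /(H _ xr).
rewrite [leRHS](bigID (mem r))/=.
rewrite (_ : \sum_(i <- r | i \in s) f i = \sum_(i <- s | i \in r) f i).
  by rewrite lerDl sumr_ge0.
rewrite -big_filter -[RHS]big_filter; apply: perm_big.
apply: uniq_perm; rewrite ?filter_uniq// => x.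
by rewrite !mem_filter andbC.
Qed.

Lemma esum_seq (r : seq X) (f : X -> R) : uniq r -> (forall x, 0 <= f x) ->
  (forall x, f x != 0 -> x \in r) ->
  (\esum_(x in [set: X]) (f x)%:E = (\sum_(x <- r) f x)%:E)%E.
Proof.
move=> ur f0 H; apply/eqP; rewrite eq_le sum_le_esum// andbT.
by apply: esum_le_of_sum => s us; apply: sum_le_sum_support => // x _; exact: H.
Qed.

Lemma exists_argmin (s : seq X) (f : X -> R) : s != [::] ->
  exists2 x, x \in s & forall y, y \in s -> f x <= f y.
Proof.
elim: s => // a [|c s] IH _.
  by exists a => [|y]; rewrite ?inE// => /eqP ->.
have [//|x xs Hx] := IH.
have [ax|/ltW xa] := leP (f a) (f x).
  exists a; first by rewrite inE eqxx.
  by move=> y; rewrite inE => /orP[/eqP ->//|/Hx]; exact: le_trans.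
exists x; first by rewrite inE xs orbT.
by move=> y; rewrite inE => /orP[/eqP ->//|/Hx].
Qed.

End list_sums.

(** * Cheeger inequality *)

(** Gives the strict decrease of the support in the induction of [coarea]. *)
Lemma count_lt {A : eqType} (s : seq A) (p q : pred A) (x0 : A) :
  (forall x, x \in s -> p x -> q x) -> x0 \in s -> q x0 -> ~~ p x0 ->
  (count p s < count q s)%N.
Proof.
move=> pq x0s qx0 npx0.
have -> : count p s = count p [seq x <- s | q x].
  rewrite count_filter; apply: eq_in_count => x xs /=.
  by case: (boolP (p x)) => // /(pq x xs) ->.
rewrite -(size_filter q s) -(count_predC p) -addn1 leq_add2l -has_count.
by apply/hasP; exists x0; rewrite ?mem_filter ?qx0.
Qed.

Section finite_cheeger.
Context {R : realType} {X : choiceType}.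
Variables (T : seq X) (b : X -> X -> R).
Hypothesis b0 : forall x y, 0 <= b x y.
Hypothesis bC : forall x y, b x y = b y x.

(* Layer-cake decomposition: remove from g its least positive value times the
   indicator of its support, and induct on the size of the support. *)
Lemma coarea (D : X -> R) (beta : R) (S : pred X) (g : X -> R) :
  (forall W : pred X, (forall x, W x -> x \in T /\ S x) ->
    beta * (\sum_(x <- T) D x * (W x)%:R) <=
    \sum_(x <- T) \sum_(y <- T) b x y * `|(W x)%:R - (W y)%:R|) ->
  (forall x, x \in T -> 0 <= g x) ->
  (forall x, x \in T -> g x != 0 -> S x) ->
  beta * (\sum_(x <- T) D x * g x) <=
  \sum_(x <- T) \sum_(y <- T) b x y * `|g x - g y|.
Proof.
move=> HW; have [n] := ubnP (count (fun x => g x != 0) T).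
elim: n g => // n IH g; rewrite ltnS => cn g0 gS.
have [/hasPn Z|hs] := boolP (~~ has (fun x => g x != 0) T).
  rewrite [X in beta * X]big1_seq ?mulr0; last first.
    by move=> x /andP[_ /Z]; rewrite negbK => /eqP ->; rewrite mulr0.
  by apply: sumr_ge0 => x _; apply: sumr_ge0 => y _; rewrite mulr_ge0.
have [|x0 x0s minx0] := @exists_argmin R X [seq x <- T | g x != 0] g.
  by move: hs; rewrite negbK has_filter.
move: x0s; rewrite mem_filter => /andP[gx0 x0T].
pose mu := g x0; pose W := [pred x | (x \in T) && (g x != 0)].
have mu0 : 0 < mu by rewrite lt_def gx0 g0.
have muW x : x \in T -> g x != 0 -> mu <= g x.
  by move=> xT gx; apply: minx0; rewrite mem_filter gx.
pose g' := fun x => g x - mu * (W x)%:R.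
have g'E x : x \in T -> g' x = if g x == 0 then 0 else g x - mu.
  move=> xT; rewrite /g' /W /= xT /=; case: eqP => [->|_] /=; last by rewrite mulr1.
  by rewrite mulr0 subr0.
have {IH} IH : beta * (\sum_(x <- T) D x * g' x) <=
    \sum_(x <- T) \sum_(y <- T) b x y * `|g' x - g' y|.
  apply: IH.
  - apply: leq_trans cn; apply: (@count_lt _ _ _ _ x0) => //.
      move=> x xT; rewrite g'E//; case: (g x == 0) => //; by rewrite eqxx.
    by rewrite g'E// (negPf gx0) subrr eqxx.
  - move=> x xT; rewrite g'E//; case: eqP => [//|/eqP gx].
    by rewrite subr_ge0 muW.
  - move=> x xT; rewrite g'E//; case: ifPn => [_|gx _]; [by rewrite eqxx|exact: gS].
have {}HW := HW W (fun x => fun H : W x => let: conj a c := andP H in conj a (gS x a c)).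
have -> : \sum_(x <- T) D x * g x =
    \sum_(x <- T) D x * g' x + mu * \sum_(x <- T) D x * (W x)%:R.
  rewrite mulr_sumr -big_split/=; apply: eq_bigr => x _; rewrite /g'; ring.
have -> : \sum_(x <- T) \sum_(y <- T) b x y * `|g x - g y| =
    \sum_(x <- T) \sum_(y <- T) b x y * `|g' x - g' y| +
    mu * \sum_(x <- T) \sum_(y <- T) b x y * `|(W x)%:R - (W y)%:R|.
  rewrite mulr_sumr -big_split/=; apply: eq_big_seq => x xT.
  rewrite mulr_sumr -big_split/=; apply: eq_big_seq => y yT.
  rewrite mulrCA -mulrDr; congr (_ * _).
  rewrite !g'E// /W /= xT yT /=.
  (* Passing from [g] to [g'] changes a difference only across the boundary of the support, and
     there by exactly [mu]. *)
  have [gx|gx] := eqVneq (g x) 0; have [gy|gy] := eqVneq (g y) 0 => /=.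
  - by rewrite gx gy !subrr normr0 mulr0 addr0.
  - rewrite gx !sub0r !normrN normr1 mulr1 !ger0_norm ?g0 ?subr_ge0 ?muW//; ring.
  - rewrite gy !subr0 normr1 mulr1 !ger0_norm ?g0 ?subr_ge0 ?muW//; ring.
  - rewrite subrr normr0 mulr0 addr0; congr (`|_|); ring.
rewrite mulrDr lerD// mulrCA ler_pM2l//.
Qed.

Lemma sum_sum_sym (F : X -> X -> R) :
  \sum_(x <- T) \sum_(y <- T) F x y = \sum_(x <- T) \sum_(y <- T) F y x.
Proof. by rewrite exchange_big. Qed.

(** Parallelogram identity. It eliminates the energy with the plus sign that arises from psi(x)^2 -
    psi(y)^2 = (psi(x) - psi(y)) (psi(x) + psi(y)). *)
Lemma sum_sqrB_add_sum_sqrD (psi : X -> R) :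
  \sum_(x <- T) \sum_(y <- T) b x y * (psi x - psi y) ^+ 2 +
  \sum_(x <- T) \sum_(y <- T) b x y * (psi x + psi y) ^+ 2 =
  4 * \sum_(x <- T) (\sum_(y <- T) b x y) * psi x ^+ 2.
Proof.
transitivity (2 * (\sum_(x <- T) \sum_(y <- T) b x y * psi x ^+ 2) +
              2 * (\sum_(x <- T) \sum_(y <- T) b y x * psi y ^+ 2)).
  rewrite !mulr_sumr -!big_split; apply: eq_bigr => x _ /=.
  rewrite !mulr_sumr -!big_split; apply: eq_bigr => y _ /=.
  rewrite (bC y x); ring.
rewrite -(sum_sum_sym (fun x y => b x y * psi x ^+ 2)) -mulrDl -natrD; congr (_ * _).
by apply: eq_bigr => x _; rewrite mulr_suml.
Qed.

(** Here [beta] is the isoperimetric constant and [gamma] is sqrt(1 - beta^2). The co-area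
    inequality is applied to psi^2. The factors 2 reflect that the double sums run over ordered
    pairs, and degrees are taken inside [T]. *)
Lemma cheeger_inequality (beta gamma : R) (psi : X -> R) :
  0 < gamma -> 0 < beta -> beta ^+ 2 + gamma ^+ 2 = 1 ->
  (forall W : pred X, (forall x, W x -> x \in T /\ psi x != 0) ->
    2 * beta * (\sum_(x <- T) (\sum_(y <- T) b x y) * (W x)%:R) <=
    \sum_(x <- T) \sum_(y <- T) b x y * `|(W x)%:R - (W y)%:R|) ->
  2 * (1 - gamma) * (\sum_(x <- T) (\sum_(y <- T) b x y) * psi x ^+ 2) <=
  \sum_(x <- T) \sum_(y <- T) b x y * (psi x - psi y) ^+ 2.
Proof.
move=> gamma0 beta0 bg /(@coarea _ _ _ (fun x => psi x ^+ 2)) H.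
have {}H : 2 * beta * (\sum_(x <- T) (\sum_(y <- T) b x y) * psi x ^+ 2) <=
   \sum_(x <- T) \sum_(y <- T) b x y * `|psi x ^+ 2 - psi y ^+ 2|.
  by apply: H => x _; rewrite ?sqr_ge0 //= sqrf_eq0.
have S := sum_sqrB_add_sum_sqrD psi.
move: H S.
set h := \sum_(x <- T) \sum_(y <- T) b x y * (psi x - psi y) ^+ 2.
set k := \sum_(x <- T) \sum_(y <- T) b x y * (psi x + psi y) ^+ 2.
set B := \sum_(x <- T) _.
set D := \sum_(x <- T) _.
move=> H S.
(* AM-GM with weights (1 + gamma) : beta, which is optimal here. *)
have P : 2 * beta * (1 + gamma) * B <= (1 + gamma) ^+ 2 * h + beta ^+ 2 * k.
  rewrite /B /h /k !mulr_sumr -big_split; apply: ler_sum => x _ /=.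
  rewrite !mulr_sumr -big_split; apply: ler_sum => y _ /=.
  rewrite (_ : psi x ^+ 2 - psi y ^+ 2 = (psi x - psi y) * (psi x + psi y)); last ring.
  rewrite normrM -(real_normK (num_real (psi x - psi y))).
  rewrite -(real_normK (num_real (psi x + psi y))).
  have := b0 x y.
  move: (b x y) `|psi x - psi y| `|psi x + psi y| => c p q c0.
  rewrite -subr_ge0 (_ : _ - _ = c * ((1 + gamma) * p - beta * q) ^+ 2); last ring.
  by rewrite mulr_ge0// sqr_ge0.
have {P} P : 2 * beta * (1 + gamma) * (2 * beta * D) <=
    (1 + gamma) ^+ 2 * h + beta ^+ 2 * k.
  by apply: le_trans P; rewrite ler_pM2l// mulr_gt0 ?mulr_gt0// addr_gt0.
(* Once k = 4 D - h is inserted, h keeps the coefficient (1 + gamma)^2 - beta^2 = 2 gamma (1 +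
   gamma). The goal multiplied by this number is [P] rearranged. *)
have gg0 : 0 < 2 * gamma * (1 + gamma) by rewrite !mulr_gt0// addr_gt0.
rewrite -(ler_pM2l gg0).
have bE : beta ^+ 2 = 1 - gamma ^+ 2 by rewrite -bg addrK.
have kE : k = 4 * D - h by rewrite -S addrC addKr.
have E : 2 * beta * (1 + gamma) * (2 * beta * D) = 4 * (1 + gamma) * D * beta ^+ 2 by ring.
move: P; rewrite E bE kE => P.
rewrite -subr_ge0 in P; rewrite -subr_ge0.
apply: le_trans P _; rewrite le_eqVlt; apply/orP; left; apply/eqP; ring.
Qed.

End finite_cheeger.

(** * Reduction to finite vertex lists, and the Cheeger inequality off a finite set *)

Section local_structure.
Context {R : realType} {X : countType}.
Variables (m : X -> R) (b : X -> X -> R).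
Hypothesis m0 : forall x, 0 < m x.
Hypothesis gb : is_graph b.
Hypothesis lf : locally_finite b.

Definition neighbours (x : X) : seq X := fset_set [set y | adj b y x].

(** At such a vertex the degree and the formal operator can be computed by summing over [T]
    alone. *)
Definition interior_vertex (T : seq X) (x : X) : Prop :=
  x \in T /\ forall y, 0 < b x y -> y \in T.

Lemma b_neq0 x y : b x y != 0 -> 0 < b x y.
Proof. by move=> bxy; rewrite lt_def bxy (graph_ge0 gb). Qed.

Lemma mem_neighbours x y : (y \in neighbours x) = (0 < b x y).
Proof.
rewrite /neighbours in_fset_set; last exact: lf.
by apply/idP/idP => [/set_mem|]; rewrite /adj /= (graph_sym gb)// => /mem_set.
Qed.

Lemma neighbours_uniq x : uniq (neighbours x).
Proof. exact: fset_uniq. Qed.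

Lemma exists_interior (S : seq X) :
  exists2 T, uniq T & forall x, x \in S -> interior_vertex T x.
Proof.
exists (undup (S ++ flatten (map neighbours S))); first exact: undup_uniq.
move=> x xS; split=> [|y bxy]; rewrite mem_undup mem_cat ?xS//.
apply/orP; right; apply/flattenP; exists (neighbours x); first exact: map_f.
by rewrite mem_neighbours.
Qed.

Lemma deg_interior T x : uniq T -> interior_vertex T x ->
  deg b x = \sum_(y <- T) b x y.
Proof.
move=> uT [xT HT]; rewrite /deg (esum_seq T)//=; first exact: (graph_ge0 gb).
by move=> y /b_neq0; exact: HT.
Qed.

Lemma degE x : deg b x = \sum_(y <- neighbours x) b x y.
Proof.
rewrite /deg (esum_seq (neighbours x)) ?neighbours_uniq//=; first exact: (graph_ge0 gb).
by move=> y /b_neq0; rewrite mem_neighbours.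
Qed.

Lemma deg_ge0 x : 0 <= deg b x.
Proof. by rewrite degE sumr_ge0// => y _; exact: (graph_ge0 gb). Qed.

(** Positive and negative parts of the summand are supported in [T], so both sums inside [usum] are
    finite and [fine] loses nothing. *)
Lemma calH_interior T u x : uniq T -> interior_vertex T x ->
  m x * calH m b u x = \sum_(y <- T) b x y * (u x - u y).
Proof.
move=> uT [xT HT]; rewrite /calH mulVKf ?gt_eqF// /usum.
set f := fun y => b x y * (u x - u y).
have f0 y : f y != 0 -> y \in T.
  by move=> fy; apply: HT; apply: b_neq0; apply: contraNneq fy => bxy; rewrite /f bxy mul0r.
rewrite !(esum_seq T)//=; first last.
- by move=> y; apply: contraNT => /(contraNeq (f0 y)) fy; rewrite /funrpos fy maxxx.
- by move=> y; apply: contraNT => /(contraNeq (f0 y)) fy; rewrite /funrneg fy oppr0 maxxx.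
rewrite -sumrB; apply: eq_bigr => y _.
by rewrite -[RHS]/(f y) -[in RHS](funrposBneg f).
Qed.

Lemma gradsqE f x : gradsq m b f x =
  ((2 * m x)^-1 * \sum_(y <- neighbours x) b x y * (f x - f y) ^+ 2)%:E.
Proof.
rewrite /gradsq (esum_seq (neighbours x)) ?neighbours_uniq//=.
  by move=> y; rewrite mulr_ge0 ?(graph_ge0 gb) ?sqr_ge0.
move=> y; rewrite mem_neighbours => bf; apply: b_neq0.
by apply: contraNneq bf => ->; rewrite mul0r.
Qed.

(* The factor 2 is there because the double sum counts every edge twice. *)
Definition hardy_off (K : seq X) (a : R) := forall (psi : X -> R) T, uniq T ->
  (forall x, psi x != 0 -> x \notin K /\ interior_vertex T x) ->
  2 * a * (\sum_(x <- T) deg b x * psi x ^+ 2) <=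
  \sum_(x <- T) \sum_(y <- T) b x y * (psi x - psi y) ^+ 2.

Lemma isoperimetric_off (beta : R) : 0 <= beta -> beta < cheeger_inf b ->
  exists2 K : set X, finite_set K & forall W : set X,
    finite_set W -> W !=set0 -> W `<=` ~` K -> beta * vol b W <= bdry b W.
Proof.
move=> beta0 beta_lt; rewrite /cheeger_inf in beta_lt.
set E := [set _ | _ in _] in beta_lt.
(* A supremum that does not exist has the default value 0, which cannot exceed [beta]. *)
have supE : has_sup E.
  apply: contrapT => /sup_out; move: beta_lt => + E0; rewrite E0 => /(le_lt_trans beta0).
  by rewrite ltxx.
have [_ [K fK <-]] : exists2 e, E e & beta < e.
  have [|e Ee] := sup_adherent _ supE (eps := sup E - beta); first by rewrite subr_gt0.
  by rewrite subKr => ?; exists e.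
move=> inf_gt; exists K => // W fW W0 WK.
have volW : 0 <= vol b W.
  by rewrite /vol fsbig_finite//; apply: sumr_ge0 => x _; exact: deg_ge0.
have bdryW V : 0 <= bdry b V.
  by apply: fine_ge0; apply: esum_ge0 => z _; rewrite lee_fin graph_ge0.
have : beta < bdry b W / vol b W.
  apply: (lt_le_trans inf_gt); apply: ge_inf; last by exists W.
  exists 0 => _ [V [fV _ _] <-]; rewrite divr_ge0//.
  by rewrite /vol fsbig_finite//; apply: sumr_ge0 => x _; exact: deg_ge0.
have [->|v0] := eqVneq (vol b W) 0; first by rewrite mulr0.
by move/ltW; rewrite ler_pdivlMr// lt_def v0.
Qed.

(** The hypothesis on [gamma] says that beta = sqrt(1 - gamma^2) lies below the Cheeger constant at
    infinity. Hence some finite K has isoperimetric constant at least beta in its complement, and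
    the finite Cheeger inequality applies to the level sets of psi^2. *)
Lemma exists_hardy_off (gamma : R) : 0 < gamma -> gamma < 1 ->
  0 < cheeger_inf b -> 1 - gamma ^+ 2 < cheeger_inf b ^+ 2 ->
  exists K, hardy_off K (1 - gamma).
Proof.
move=> gamma0 gamma1 alpha0 Halpha.
have bg0 : 0 < 1 - gamma ^+ 2 by rewrite subr_gt0 expr_lt1 ?ltW.
pose beta := Num.sqrt (1 - gamma ^+ 2).
have beta0 : 0 < beta by rewrite sqrtr_gt0.
have betaE : beta ^+ 2 = 1 - gamma ^+ 2 by rewrite sqr_sqrtr// ltW.
have [||K fK HK] := isoperimetric_off beta; first exact: ltW.
  by rewrite -(ltr_pXn2r (n := 2)) ?nnegrE ?ltW// betaE.
exists (fset_set K) => psi T uT Hpsi.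
have intT x : psi x != 0 -> interior_vertex T x by move=> /Hpsi[].
have -> : \sum_(x <- T) deg b x * psi x ^+ 2 =
          \sum_(x <- T) (\sum_(y <- T) b x y) * psi x ^+ 2.
  apply: eq_bigr => x _; have [->|/intT xT] := eqVneq (psi x) 0.
    by rewrite expr0n !mulr0.
  by rewrite -deg_interior.
apply: (cheeger_inequality _ _ (graph_ge0 gb) (graph_sym gb) beta) => //.
  by rewrite betaE subrK.
move=> W HW; pose W' := [set x | W x].
have [|/hasPn nW] := boolP (has W T); last first.
  rewrite big1_seq ?mulr0; last by move=> x /andP[_ /nW /negPf ->]; rewrite mulr0.
  by do 2![apply: sumr_ge0 => ? _]; rewrite mulr_ge0 ?(graph_ge0 gb).
move=> /hasP[x0 x0T Wx0].
have fW : finite_set W' by apply: (sub_finite_set _ (finite_seq T)) => x /HW[].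
have WK : W' `<=` ~` K.
  by move=> x /HW[_ /Hpsi[+ _]]; rewrite in_fset_set// notin_setE.
have intW x : W x -> interior_vertex T x by move=> /HW[_ /intT].
have {HK} := HK W' fW (ex_intro _ x0 Wx0) WK.
have -> : vol b W' = \sum_(x <- T) (\sum_(y <- T) b x y) * (W x)%:R.
  rewrite /vol (fsbigE [seq x <- T | W x]); first last.
  - by move=> x Wx; rewrite mem_filter Wx (intW _ Wx).1.
  - by move=> x /=; rewrite mem_filter => /andP[].
  - exact: filter_uniq.
  rewrite big_filter_cond [RHS](bigID W)/= [X in _ + X]big1 ?addr0; last first.
    by move=> x /negPf ->; rewrite mulr0.
  apply: eq_big => x; first by rewrite mem_setE andbb.
  by move=> /andP[Wx _]; rewrite Wx mulr1 (deg_interior T)//; exact: intW.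
(* Every vertex of [W] is interior to [T], so all boundary edges have both endpoints in [T]. *)
have -> : bdry b W' = \sum_(x <- T) \sum_(y <- T) b x y * ((W x)%:R * (~~ W y)%:R).
  rewrite /bdry esum_mkcond.
  rewrite (eq_esum (b := fun z => (b z.1 z.2 * ((W z.1)%:R * (~~ W z.2)%:R))%:E)); last first.
    move=> [x y] _ /=; rewrite in_setX in_setC !mem_setE /=.
    rewrite -!topredE /=; by case: (W x); case: (W y); rewrite /= ?(mulr1, mulr0, mul0r).
  rewrite (esum_seq [seq (x, y) | x <- T, y <- T])/= ?big_allpairs//.
  - by apply: allpairs_uniq => // -[? ?] [? ?].
  - by move=> z; rewrite !mulr_ge0// (graph_ge0 gb).
  - move=> [x y] /=; have [Wx|] := boolP (W x); last by rewrite mul0r mulr0 eqxx.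
    rewrite mul1r => bn; have {}bn : 0 < b x y.
      by apply: b_neq0; apply: contraNneq bn => ->; rewrite mul0r.
    by apply/allpairsP; exists (x, y); have [? H] := intW _ Wx; split=> //; exact: H.
have -> : \sum_(x <- T) \sum_(y <- T) b x y * `|(W x)%:R - (W y)%:R| =
  2 * \sum_(x <- T) \sum_(y <- T) b x y * ((W x)%:R * (~~ W y)%:R) :> R.
  rewrite mulr_natl mulr2n.
  rewrite [X in _ = X + _](sum_sum_sym T (fun x y => b x y * ((W x)%:R * (~~ W y)%:R))).
  rewrite -big_split; apply: eq_bigr => x _; rewrite -big_split; apply: eq_bigr => y _ /=.
  rewrite (graph_sym gb y x) -mulrDr; congr (_ * _).
  by case: (W x); case: (W y); 
    rewrite /= ?(mulr1, mulr0, addr0, add0r, subr0, sub0r, subrr, normrN, normr1, normr0).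
by rewrite -mulrA ler_pM2l.
Qed.

End local_structure.

(** * Agmon estimate *)

(** The hypothesis depends only on the ratio s/t, and truncation at N moves this ratio towards 1. In
    the one nontrivial case s <= N < t this is (t - s)^2 N - (N - s)^2 t = (t - N) (N t - s^2) >=
    0. *)
Lemma truncate_ratio {R : realFieldType} (k N s t : R) :
  0 < N -> 0 < s -> 0 < t -> 0 <= k -> (s - t) ^+ 2 <= k * s * t ->
  (Num.min s N - Num.min t N) ^+ 2 <= k * Num.min s N * Num.min t N.
Proof.
move=> N0; wlog st : s t / s <= t.
  move=> H s0 t0 k0 kst; have [/H|/ltW ts] := leP s t; first exact.
  rewrite -sqrrN opprB -mulrA (mulrC (Num.min s N)) mulrA; apply: H => //.
  by rewrite -sqrrN opprB -mulrA (mulrC t) mulrA.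
move=> s0 t0 k0 kst.
have [sN|Ns] := leP s N; last first.
  have [tN|Nt] := leP t N; first by have := lt_le_trans Ns (le_trans st tN); rewrite ltxx.
  by rewrite subrr expr0n !mulr_ge0// ltW.
have [//|Nt] := leP t N.
rewrite -(ler_pM2r t0); apply: (@le_trans _ _ ((s - t) ^+ 2 * N)); last first.
  by rewrite (_ : _ * t = k * s * t * N) ?ler_pM2r//; ring.
rewrite -subr_ge0 (_ : _ - _ = (t - N) * (N * t - s * s)); last ring.
by rewrite mulr_ge0// subr_ge0 ?ler_pM// ltW.
Qed.

(** Leibniz rule with midpoint values, followed by Young's inequality with parameter [eps]. The
    squared midpoint of c1, c2 is c1 c2 + (c1 - c2)^2 / 4, so the gradient of f comes with the
    product c1 c2 up to an error in the gradient of c. *)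
Lemma sqr_product_diff_le {R : realFieldType} (eps N P f1 f2 c1 c2 : R) :
  0 < eps -> 0 <= f1 <= N -> 0 <= f2 <= N -> (f1 - f2) ^+ 2 * (c1 * c2) <= P ->
  (f1 * c1 - f2 * c2) ^+ 2 <=
  (1 + eps) * P + N ^+ 2 * ((1 + eps) / 4 + 1 + eps^-1) * (c1 - c2) ^+ 2.
Proof.
move=> e0 /andP[f10 f1N] /andP[f20 f2N] HP.
set p := f1 - f2; set q := (c1 + c2) / 2; set r := (f1 + f2) / 2; set s := c1 - c2.
have -> : f1 * c1 - f2 * c2 = p * q + r * s by rewrite /p /q /r /s; field.
have N0 : 0 <= N := le_trans f10 f1N.
have pN : p ^+ 2 <= N ^+ 2.
  rewrite -(real_normK (num_real p)) ler_pXn2r ?nnegrE// ler_norml /p; lra.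
have rN : r ^+ 2 <= N ^+ 2 by rewrite ler_pXn2r// /r ?nnegrE; lra.
have qE : q ^+ 2 = c1 * c2 + s ^+ 2 / 4 by rewrite /q /s; field.
apply: (@le_trans _ _ ((1 + eps) * (p ^+ 2 * q ^+ 2) + (1 + eps^-1) * (r ^+ 2 * s ^+ 2))).
  rewrite -subr_ge0 (_ : _ - _ = (eps * (p * q) - r * s) ^+ 2 / eps); last first.
    by field; rewrite gt_eqF.
  by rewrite divr_ge0 ?sqr_ge0 ?ltW.
have ei : 0 < eps^-1 by rewrite invr_gt0.
have s0 := sqr_ge0 s.
have A1 : p ^+ 2 * q ^+ 2 <= P + N ^+ 2 * (s ^+ 2 / 4).
  by rewrite qE mulrDr lerD// ler_wpM2r// divr_ge0.
have A2 : r ^+ 2 * s ^+ 2 <= N ^+ 2 * s ^+ 2 by rewrite ler_wpM2r.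
by apply: (le_trans (lerD (ler_wpM2l _ A1) (ler_wpM2l _ A2))); lra.
Qed.

Section agmon.
Context {R : realType} {X : countType}.
Variables (m : X -> R) (b : X -> X -> R).
Hypothesis m0 : forall x, 0 < m x.
Hypothesis gb : is_graph b.
Hypothesis lf : locally_finite b.

(** Pointwise, (u(x) phi(x) - u(y) phi(y))^2 equals (u(x) - u(y)) (u(x) phi(x)^2 - u(y) phi(y)^2) +
    u(x) u(y) (phi(x) - phi(y))^2. By symmetry, the two halves of the first term have the same
    sum. *)
Lemma sqr_form_product (T : seq X) (u phi : X -> R) :
  \sum_(x <- T) \sum_(y <- T) b x y * (u x * phi x - u y * phi y) ^+ 2 =
  2 * (\sum_(x <- T) phi x ^+ 2 * u x * \sum_(y <- T) b x y * (u x - u y)) +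
  \sum_(x <- T) \sum_(y <- T) b x y * (u x * u y * (phi x - phi y) ^+ 2).
Proof.
pose F x y := phi x ^+ 2 * u x * (b x y * (u x - u y)).
transitivity (\sum_(x <- T) \sum_(y <- T) F x y + \sum_(x <- T) \sum_(y <- T) F y x
  + \sum_(x <- T) \sum_(y <- T) b x y * (u x * u y * (phi x - phi y) ^+ 2)).
  rewrite -!big_split; apply: eq_bigr => x _ /=.
  rewrite -!big_split; apply: eq_bigr => y _ /=.
  by rewrite /F (graph_sym gb y x); ring.
rewrite -(sum_sum_sym T F) mulr_natl mulr2n; congr (_ + _ + _);
  by apply: eq_bigr => x _; rewrite mulr_sumr.
Qed.

Lemma sum_sum_mul_le (T : seq X) (w : X -> X -> R) (f : X -> R) :
  (forall x y, 0 <= w x y) -> (forall x y, w x y = w y x) ->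
  \sum_(x <- T) \sum_(y <- T) w x y * (`|f x| * `|f y|) <=
  \sum_(x <- T) f x ^+ 2 * \sum_(y <- T) w x y.
Proof.
move=> w0 wC.
rewrite (_ : \sum_(x <- T) f x ^+ 2 * _ =
    \sum_(x <- T) \sum_(y <- T) w x y * f x ^+ 2); last first.
  by apply: eq_bigr => x _; rewrite mulr_sumr; apply: eq_bigr => y _; rewrite mulrC.
rewrite -(ler_pM2l (ltr0n R 2)) [leRHS]mulr_natl mulr2n.
rewrite [X in _ <= _ + X](sum_sum_sym T (fun x y => w x y * f x ^+ 2)).
rewrite mulr_sumr -big_split; apply: ler_sum => x _ /=.
rewrite mulr_sumr -big_split; apply: ler_sum => y _ /=.
rewrite (wC y x) -mulrDr mulrCA ler_wpM2l//.
rewrite -(real_normK (num_real (f x))) -(real_normK (num_real (f y))).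
rewrite -subr_ge0 (_ : _ - _ = (`|f x| - `|f y|) ^+ 2) ?sqr_ge0//; ring.
Qed.

(** The common consequence of cases (a) and (b) that the Agmon estimate uses. The lower bound 1/2 on
    [F] only costs a factor 4. *)
Definition has_cutoffs (u : X -> R) : Prop := forall (F : seq X) (e : R), 0 < e ->
  exists (chi : X -> R) (S : seq X), [/\ forall x, chi x != 0 -> x \in S,
    forall x, 0 <= chi x <= 1, forall x, x \in F -> 1 / 2 <= chi x &
    forall T, uniq T ->
      \sum_(x <- T) \sum_(y <- T) b x y * (u x ^+ 2 * (chi x - chi y) ^+ 2) <= e].

(** Here [kappa] bounds the relative oscillation of the weight [g] along edges; the last hypothesis
    absorbs it, together with [lambda], into a part c < a of the Hardy weight. The constant is fixed
    before [F], hence before the truncation level and the cutoff. *)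
Lemma agmon (u g : X -> R) (lambda a c eps : R) (K : seq X)
    (kappa : X -> X -> R) :
  hardy_off b K a -> (forall x, u x * calH m b u x <= lambda * u x ^+ 2) ->
  has_cutoffs u -> (forall x, 0 < g x) ->
  (forall x y, 0 <= kappa x y) -> (forall x y, kappa x y = kappa y x) ->
  (forall x y, 0 < b x y -> (g x - g y) ^+ 2 <= kappa x y * g x * g y) ->
  0 < eps -> c < a ->
  (forall x T, x \notin K -> uniq T ->
     lambda * m x + (1 + eps) / 2 * (\sum_(y <- T) b x y * kappa x y) <= c * deg b x) ->
  exists C, forall F, uniq F -> \sum_(x <- F) u x ^+ 2 * (g x ^+ 2 * deg b x) <= C.
Proof.
move=> hardyK Hu cut g0 kappa0 kappaC gk eps0 ca HK.
have b0 := graph_ge0 gb; have bC := graph_sym gb; have dg0 := deg_ge0 b gb lf.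
(* Contribution of the edges starting in [K]. It carries the untruncated weight, so that [C0] does
   not depend on [F]. *)
pose bd x y := (x \in K)%:R * (b x y * (`|u x| * `|u y| * g y ^+ 2)).
have bd0 x y : 0 <= bd x y.
  by rewrite /bd mulr_ge0// mulr_ge0// mulr_ge0 ?sqr_ge0// mulr_ge0.
pose C0 := \sum_(x <- undup K) \sum_(y <- neighbours b x) bd x y.
pose C1 := (2 * (1 + eps) * C0 + 1) / (2 * (a - c)).
exists (\sum_(x <- undup K) u x ^+ 2 * (g x ^+ 2 * deg b x) + 4 * C1) => F uF.
(* At this level the truncation does not change [g] on [F]; the summand 1 keeps the level
   positive. *)
pose N := 1 + \sum_(x <- F) g x.
have sg0 : 0 <= \sum_(x <- F) g x by apply: sumr_ge0 => x _; rewrite ltW.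
have N0 : 0 < N by rewrite ltr_wpDr.
have gN x : x \in F -> g x <= N.
  move=> xF; rewrite /N (perm_big _ (perm_to_rem xF)) big_cons/= addrCA lerDl addr_ge0//.
  by apply: sumr_ge0 => y _; rewrite ltW.
(* The coefficient of the cutoff gradient in [sqr_product_diff_le]. Cutoff energy at most 1/k makes
   that contribution at most 1, the summand 1 in [C1]. *)
pose k := N ^+ 2 * ((1 + eps) / 4 + 1 + eps^-1).
have k0 : 0 < k.
  by rewrite mulr_gt0 ?exprn_gt0// addr_gt0 ?invr_gt0// addr_gt0// divr_gt0// addr_gt0.
have [|chi [S [chiS chi01 chiF chiE]]] := cut F k^-1; first by rewrite invr_gt0.
have [T uT intT] := exists_interior b gb lf S.
pose f x := Num.min (g x) N.
have f0 x : 0 < f x by rewrite lt_min g0 N0.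
have fN x : f x <= N by rewrite ge_min lexx orbT.
have fg x : f x <= g x by rewrite ge_min lexx.
pose phi x := (if x \in K then 0 else f x) * chi x.
have phiP x : phi x != 0 -> x \notin K /\ interior_vertex b T x.
  rewrite /phi; case: ifP => xK; first by rewrite mul0r eqxx.
  by rewrite mulf_eq0 negb_or => /andP[_ /chiS /intT].
pose D := \sum_(x <- T) deg b x * (u x * phi x) ^+ 2.
have P1 : 2 * a * D <=
    \sum_(x <- T) \sum_(y <- T) b x y * (u x * phi x - u y * phi y) ^+ 2.
  by apply: hardyK => // x; rewrite mulf_eq0 negb_or => /andP[_ /phiP].
have P2 : \sum_(x <- T) phi x ^+ 2 * u x * (\sum_(y <- T) b x y * (u x - u y)) <=
    \sum_(x <- T) lambda * m x * (u x * phi x) ^+ 2.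
  apply: ler_sum => x _; have [->|/phiP[_ xT]] := eqVneq (phi x) 0.
    by rewrite !(mulr0, expr0n, mul0r).
  rewrite -(calH_interior m b m0 gb T u x uT xT).
  rewrite (_ : _ * (m x * _) = (m x * phi x ^+ 2) * (u x * calH m b u x)); last ring.
  rewrite (_ : lambda * _ * _ = (m x * phi x ^+ 2) * (lambda * u x ^+ 2)); last ring.
  by rewrite ler_wpM2l// mulr_ge0 ?sqr_ge0// ltW.
have P3 : \sum_(x <- T) \sum_(y <- T) b x y * (u x * u y * (phi x - phi y) ^+ 2) <=
    (1 + eps) * (\sum_(x <- T) (u x * phi x) ^+ 2 * \sum_(y <- T) b x y * kappa x y)
    + (1 + eps) * (2 * C0) + 1.
  have Q1 x y : b x y * (u x * u y * (phi x - phi y) ^+ 2) <=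
     (1 + eps) * (b x y * kappa x y * (`|u x * phi x| * `|u y * phi y|))
     + (1 + eps) * (bd x y + bd y x)
     + k * (b x y * (`|u x| * `|u y| * (chi x - chi y) ^+ 2)).
    have b00 := b0 x y; have u00 : 0 <= `|u x| * `|u y| by rewrite mulr_ge0.
    have /andP[cx0 cx1] := chi01 x; have /andP[cy0 cy1] := chi01 y.
    (* If neither endpoint is in [K], the oscillation bound on [g] survives truncation. Otherwise
       phi vanishes at an endpoint in [K], and the square of the weight at the other endpoint is
       used instead. *)
    pose P := kappa x y * (phi x * phi y) + (x \in K)%:R * g y ^+ 2
              + (y \in K)%:R * g x ^+ 2.
    have bP : b x y * (phi x - phi y) ^+ 2 <=
        b x y * ((1 + eps) * P + k * (chi x - chi y) ^+ 2).
      have [->|/(b_neq0 b gb)/gk gxy] := eqVneq (b x y) 0; first by rewrite !mul0r.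
      rewrite ler_wpM2l// sqr_product_diff_le//.
      - by case: ifP => _; rewrite ?lexx ?(ltW N0)// fN ltW.
      - by case: ifP => _; rewrite ?lexx ?(ltW N0)// fN ltW.
      rewrite /P /phi; case: ifP => xK; case: ifP => yK.
      - by rewrite subrr expr0n !mul0r mulr0 !mul1r add0r addr_ge0 ?sqr_ge0.
      - rewrite !mul0r mulr0 mul1r !add0r addr0 sqrrN.
        apply: (@le_trans _ _ (f y ^+ 2)).
          by rewrite -[leRHS]mulr1 ler_wpM2l ?sqr_ge0// mulr_ile1.
        by rewrite ler_pXn2r ?nnegrE// ltW.
      - rewrite !mul0r !mulr0 mul1r !add0r subr0.
        apply: (@le_trans _ _ (f x ^+ 2)).
          by rewrite -[leRHS]mulr1 ler_wpM2l ?sqr_ge0// mulr_ile1.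
        by rewrite ler_pXn2r ?nnegrE// ltW.
      - rewrite !mul0r !addr0.
        rewrite [leRHS](_ : _ = kappa x y * f x * f y * (chi x * chi y)); last ring.
        rewrite ler_wpM2r ?mulr_ge0//.
        exact: truncate_ratio.
    have phi_ge0 z : 0 <= phi z.
      rewrite /phi mulr_ge0//; last by have /andP[] := chi01 z.
      by case: ifP => // _; rewrite ltW.
    rewrite (normrM (u x)) (normrM (u y)) (ger0_norm (phi_ge0 x)) (ger0_norm (phi_ge0 y)).
    apply: (@le_trans _ _ (`|u x| * `|u y| * (b x y * (phi x - phi y) ^+ 2))).
      rewrite [leRHS]mulrCA ler_wpM2l// ler_wpM2r ?sqr_ge0//.
      by rewrite -normrM ler_norm.
    apply: (le_trans (ler_wpM2l u00 bP)); rewrite le_eqVlt; apply/orP; left; apply/eqP.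
    by rewrite /P /bd (bC y x); ring.
  have C0P : \sum_(x <- T) \sum_(y <- T) bd x y <= C0.
    apply: (@le_trans _ _ (\sum_(x <- T) \sum_(y <- neighbours b x) bd x y)).
      apply: ler_sum => x _; apply: sum_le_sum_support; rewrite ?neighbours_uniq//.
      move=> y _ bdn; rewrite mem_neighbours//; apply: b_neq0 => //.
      by apply: contraNneq bdn => bxy; rewrite /bd bxy !(mul0r, mulr0).
    apply: sum_le_sum_support; rewrite ?undup_uniq//.
      by move=> x; exact: sumr_ge0.
    move=> x _; rewrite mem_undup; apply: contraR => /negPf xK.
    by rewrite big1// => y _; rewrite /bd xK mul0r.
  clearbody bd.
  have chiP : k * (\sum_(x <- T) \sum_(y <- T)
      b x y * (chi x - chi y) ^+ 2 * (`|u x| * `|u y|)) <= 1.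
    rewrite -[leRHS](mulfV (lt0r_neq0 k0)) ler_pM2l//; apply: le_trans (chiE T uT).
    apply: le_trans (sum_sum_mul_le T _ u _ _) _.
    - by move=> x y; rewrite mulr_ge0 ?sqr_ge0.
    - by move=> x y; rewrite (bC y x) -[in RHS]sqrrN opprB.
    by apply: ler_sum => x _; rewrite mulr_sumr; apply: ler_sum => y _; rewrite mulrCA.
  have kP := sum_sum_mul_le T (fun x y => b x y * kappa x y) (fun x => u x * phi x)
    (fun x y => mulr_ge0 (b0 x y) (kappa0 x y)) (fun x y => congr2 *%R (bC x y) (kappaC x y)).
  apply: le_trans (ler_sum _ (fun x _ => ler_sum _ (fun y _ => Q1 x y))) _.
  rewrite (eq_bigr (fun x =>
     (1 + eps) * (\sum_(y <- T) b x y * kappa x y * (`|u x * phi x| * `|u y * phi y|))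
     + (1 + eps) * (\sum_(y <- T) bd x y + \sum_(y <- T) bd y x)
     + k * (\sum_(y <- T) b x y * (chi x - chi y) ^+ 2 * (`|u x| * `|u y|)))); last first.
    move=> x _; rewrite !big_split/= -!mulr_sumr big_split/=; congr (_ + _ * _).
    by apply: eq_bigr => y _; ring.
  rewrite !big_split/= -!mulr_sumr big_split/=.
  rewrite -(sum_sum_sym T bd) lerD//.
  have e1 : 0 <= 1 + eps by rewrite addr_ge0// ltW.
  by rewrite lerD// ler_wpM2l// mulr_natl mulr2n lerD.
have P4 : 2 * (a - c) * D <= 2 * (1 + eps) * C0 + 1.
  have E : 2 * (\sum_(x <- T) lambda * m x * (u x * phi x) ^+ 2) +
      (1 + eps) * (\sum_(x <- T) (u x * phi x) ^+ 2 * \sum_(y <- T) b x y * kappa x y)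
      <= 2 * c * D.
    rewrite /D !mulr_sumr -big_split; apply: ler_sum => x _ /=.
    have [->|/phiP[xK _]] := eqVneq (phi x) 0.
      by rewrite !(mulr0, expr0n, mul0r, addr0).
    have := ler_wpM2l (sqr_ge0 (u x * phi x)) (HK x T xK uT); lra.
  have := sqr_form_product T u phi; lra.
have {}P4 : D <= C1.
  by rewrite /C1 ler_pdivlMr ?mulr_gt0 ?subr_gt0// mulrC.
(* The part of [F] in [K] is covered by the first summand of the constant. On the rest the
   truncation is inactive and chi^2 >= 1/4, whence the bound 4 D. *)
rewrite (bigID (mem K))/= lerD//.
  rewrite -big_filter; apply: sum_le_sum_support; rewrite ?filter_uniq ?undup_uniq//.
    by move=> x; rewrite mulr_ge0 ?sqr_ge0// mulr_ge0 ?sqr_ge0.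
  by move=> x; rewrite mem_filter mem_undup => /andP[].
apply: (@le_trans _ _ (4 * D)); last by rewrite ler_pM2l.
apply: (@le_trans _ _ (4 * \sum_(x <- F | x \notin K) deg b x * (u x * phi x) ^+ 2)).
  rewrite mulr_sumr big_seq_cond [leRHS]big_seq_cond; apply: ler_sum => x /andP[xF /negPf xK].
  rewrite /phi xK /f min_l ?gN//.
  have chi2 : 1 <= 4 * chi x ^+ 2 by have := chiF x xF; nra.
  have q0 : 0 <= deg b x * (u x * g x) ^+ 2 by rewrite mulr_ge0 ?sqr_ge0.
  have := ler_wpM2l q0 chi2; lra.
rewrite ler_pM2l// -big_filter; apply: sum_le_sum_support; rewrite ?filter_uniq//.
  by move=> x; rewrite mulr_ge0 ?sqr_ge0.
move=> x _; have [->|/phiP[_ []]//] := eqVneq (phi x) 0.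
by rewrite !mulr0 expr0n mulr0 eqxx.
Qed.

End agmon.

(** * Cutoff functions *)

Lemma near_lt_of_cvg0 {R : realType} (f : nat -> \bar R) (e : R) :
  f @ \oo --> 0%E -> 0 < e -> \forall n \near \oo, (f n < e%:E)%E.
Proof. by move=> cv e0; apply: (cv [set y | (y < e%:E)%E]); exact: open_ereal_lt'. Qed.

Section cutoffs.
Context {R : realType} {X : countType}.
Variables (m : X -> R) (b : X -> X -> R).
Hypothesis m0 : forall x, 0 < m x.
Hypothesis gb : is_graph b.
Hypothesis lf : locally_finite b.

(** The real number 2 m |nabla f|^2, a finite sum by local finiteness. *)
Definition grad2 (f : X -> R) x :=
  \sum_(y <- neighbours b x) b x y * (f x - f y) ^+ 2.

Lemma grad2_ge0 f x : 0 <= grad2 f x.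
Proof. by apply: sumr_ge0 => y _; rewrite mulr_ge0 ?sqr_ge0// (graph_ge0 gb). Qed.

Lemma gradsq_mul_m f x : (gradsq m b f x * (m x)%:E)%E = (grad2 f x / 2)%:E.
Proof.
rewrite gradsqE// -EFinM; congr (_%:E); rewrite -/(grad2 f x).
by field; rewrite gt_eqF.
Qed.

Lemma sum_sqr_le_grad2 T f x : uniq T ->
  \sum_(y <- T) b x y * (f x - f y) ^+ 2 <= grad2 f x.
Proof.
move=> uT; apply: sum_le_sum_support; rewrite ?neighbours_uniq//.
  by move=> y; rewrite mulr_ge0 ?sqr_ge0// (graph_ge0 gb).
move=> y _ bf; rewrite mem_neighbours//; apply: b_neq0 => //.
by apply: contraNneq bf => ->; rewrite mul0r.
Qed.

Lemma near_all_seq (F : seq X) (P : nat -> X -> Prop) :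
  (forall x, \forall n \near \oo, P n x) ->
  \forall n \near \oo, forall x, x \in F -> P n x.
Proof.
move=> H; elim: F => [|a F IH]; first by near=> n.
near=> n => x; rewrite inE => /orP[/eqP ->|]; first by near: n; exact: H.
by move: x; near: n.
Unshelve. all: by end_near.
Qed.

(** A late member of the approximating sequence serves: it is at most 1 because the sequence
    increases to 1, at least 1/2 on the finite list, and of small weighted energy. *)
Lemma approximable_has_cutoffs u : approximable m b u -> has_cutoffs b u.
Proof.
move=> [phi [phiC phi0 phi_nd phi1 phiE]] F e e0.
have phi_le1 n x : phi n x <= 1.
  have := phi1 x => /[dup] cv /cvg_lim <-//.
  by apply: (nondecreasing_cvgn_le (phi_nd x)); apply/cvg_ex; exists 1.
have [n [Hn1 Hn2]] : exists n, (forall x, x \in F -> 1 / 2 <= phi n x) /\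
    (\esum_(x in [set: X]) (((u x) ^+ 2)%:E * gradsq m b (phi n) x * (m x)%:E) <= (e / 2)%:E)%E.
  have A1 : \forall n \near \oo, forall x, x \in F -> 1 / 2 <= phi n x.
    apply: near_all_seq => x.
    by apply: (cvgr_ge _ (phi1 x)); lra.
  have A2 : \forall n \near \oo, (\esum_(x in [set: X])
      (((u x) ^+ 2)%:E * gradsq m b (phi n) x * (m x)%:E) < (e / 2)%:E)%E.
    by apply: near_lt_of_cvg0 => //; rewrite divr_gt0.
  have [n [N1 N2]] := @filter_ex _ _ _ _ (filterI A1 A2).
  by exists n; split=> //; exact: ltW.
exists (phi n), (fset_set [set x | phi n x != 0]); split => //.
- by move=> x phix; rewrite in_fset_set ?mem_set//; exact: phiC.
- by move=> x; rewrite phi0 phi_le1.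
move=> T uT.
have G x : (((u x) ^+ 2)%:E * gradsq m b (phi n) x * (m x)%:E)%E =
    (u x ^+ 2 * grad2 (phi n) x / 2)%:E.
  by rewrite -muleA gradsq_mul_m -EFinM mulrA.
apply: (@le_trans _ _ (2 * \sum_(x <- T) u x ^+ 2 * grad2 (phi n) x / 2)).
  rewrite mulr_sumr; apply: ler_sum => x _; rewrite mulrC divfK//.
  rewrite (eq_bigr (fun y => u x ^+ 2 * (b x y * (phi n x - phi n y) ^+ 2))).
    by rewrite -mulr_sumr ler_wpM2l ?sqr_ge0// sum_sqr_le_grad2.
  by move=> y _; rewrite mulrCA.
rewrite -ler_pdivlMl// mulrC -lee_fin; apply: le_trans Hn2.
rewrite (eq_esum (fun x _ => G x)); apply: sum_le_esum => // x.
by rewrite divr_ge0// mulr_ge0 ?sqr_ge0 ?grad2_ge0.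
Qed.

(** A finite sum within [e] of the supremum leaves at most [e] for any disjoint list. *)
Lemma summable_tail (h : X -> R) (F : seq X) (C e : R) : (forall x, 0 <= h x) ->
  (forall r, uniq r -> \sum_(x <- r) h x <= C) -> 0 < e ->
  exists2 S : seq X, {subset F <= S} &
    forall r, uniq r -> (forall x, x \in r -> x \notin S) -> \sum_(x <- r) h x <= e.
Proof.
move=> h0 hC e0; pose E := [set \sum_(x <- r) h x | r in [set r : seq X | uniq r]].
have supE : has_sup E.
  split; first by exists (\sum_(x <- [::]) h x), [::].
  by exists C => _ [r ur <-]; exact: hC.
have [_ [S0 uS0 <-] HS0] := sup_adherent e0 supE.
exists (undup (S0 ++ F)) => [x xF|r ur rS]; first by rewrite mem_undup mem_cat xF orbT.
have : \sum_(x <- S0 ++ r) h x <= sup E.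
  apply: ub_le_sup; first exact: supE.2.
  exists (S0 ++ r) => //=; rewrite cat_uniq uS0 ur andbT; apply/hasPn => x /rS.
  by rewrite mem_undup mem_cat negb_or => /andP[].
rewrite big_cat/=; move: HS0; set s := \sum_(x <- S0) _; lra.
Qed.

(** The cutoff is the indicator of a list containing S and all neighbours of S. Its gradient
    vanishes on S, and elsewhere the energy density is at most deg u^2, whose tail off S is
    small. *)
Lemma l2_deg_has_cutoffs (u : X -> R) C :
  (forall F, uniq F -> \sum_(x <- F) deg b x * u x ^+ 2 <= C) -> has_cutoffs b u.
Proof.
move=> HC F e e0; have dg0 := deg_ge0 b gb lf; have b0 := graph_ge0 gb.
have [x|S FS HS] := summable_tail (fun x => deg b x * u x ^+ 2) F C e _ HC e0.
  by rewrite mulr_ge0 ?sqr_ge0.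
have [T0 uT0 intT0] := exists_interior b gb lf S.
exists (fun x => (x \in T0)%:R), T0; split.
- by move=> x; case: (x \in T0) => //; rewrite eqxx.
- by move=> x; case: (x \in T0); rewrite ?lexx ler01.
- by move=> x /FS/intT0[-> _]; rewrite (_ : true%:R = 1 :> R)//; lra.
move=> T uT.
apply: (@le_trans _ _ (\sum_(x <- [seq x <- T | x \notin S]) deg b x * u x ^+ 2)); last first.
  by apply: HS; rewrite ?filter_uniq// => x; rewrite mem_filter => /andP[].
rewrite big_filter [leRHS]big_mkcond/=; apply: ler_sum => x _.
case: ifPn => [xS|]; last first.
  rewrite negbK => /intT0[xT0 HT0]; rewrite big1// => y _.
  have [->|/(b_neq0 b gb)/HT0 yT0] := eqVneq (b x y) 0; first by rewrite mul0r.
  by rewrite xT0 yT0 subrr expr0n !mulr0.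
apply: (@le_trans _ _ (\sum_(y <- T) b x y * u x ^+ 2)).
  apply: ler_sum => y _; rewrite ler_wpM2l// -[leRHS]mulr1 ler_wpM2l ?sqr_ge0//.
  by case: (x \in T0); case: (y \in T0); rewrite ?subrr ?subr0 ?sub0r ?sqrrN ?expr1n ?expr0n.
rewrite -mulr_suml ler_wpM2r ?sqr_ge0// degE//; apply: sum_le_sum_support => //.
  exact: neighbours_uniq.
by move=> y _ /(b_neq0 b gb); rewrite mem_neighbours.
Qed.

(** Finite support and local finiteness make the energy a finite sum, so [fine] in [hquad] does not
    replace an infinite value by 0. *)
Lemma hquad_Cc f T : Cc f -> uniq T ->
  \sum_(x <- T) \sum_(y <- T) b x y * (f x - f y) ^+ 2 <= 2 * hquad m b f.
Proof.
move=> fC uT; have [S uS intS] := exists_interior b gb lf (fset_set [set x | f x != 0]).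
have g0 x : 0 <= grad2 f x / 2 by rewrite divr_ge0// grad2_ge0.
have supp x : grad2 f x / 2 != 0 -> x \in S.
  apply: contraR => xS; rewrite /grad2 big1 ?mul0r// => y _.
  have fS z : z \notin S -> f z = 0.
    apply: contraNeq => fz; apply: (intS z _).1.
    by rewrite in_fset_set// mem_set.
  rewrite (fS x xS); have [->|/(b_neq0 b gb) bxy] := eqVneq (b x y) 0; first by rewrite mul0r.
  have [->|fy] := eqVneq (f y) 0; first by rewrite subrr expr0n mulr0.
  have [|_ HS] := intS y; first by rewrite in_fset_set// mem_set.
  by move: xS; rewrite HS// (graph_sym gb).
rewrite /hquad (eq_esum (fun x _ => gradsq_mul_m f x)) (esum_seq S)//=.
apply: (@le_trans _ _ (2 * \sum_(x <- T) grad2 f x / 2)).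
  rewrite mulr_sumr; apply: ler_sum => x _; rewrite mulrC divfK//.
  exact: sum_sqr_le_grad2.
by rewrite ler_pM2l//; apply: sum_le_sum_support => // x _; exact: supp.
Qed.

Lemma form_approx_close phi u (F : seq X) (w : X -> R) : form_approx m b phi u ->
  uniq F -> (forall x, 0 <= w x) ->
  \forall i \near \oo, \sum_(x <- F) w x * (phi i x - u x) ^+ 2 <= 1.
Proof.
(* On the finite list [F] the weight [w] is at most [M] times [m], so convergence in l^2(X, m)
   suffices. *)
move=> [_ cv _] uF w0; pose M := 1 + \sum_(x <- F) w x / m x.
have wm x : 0 <= w x / m x by rewrite divr_ge0// ltW.
have M0 : 0 < M by rewrite ltr_wpDr// sumr_ge0.
have wM x : x \in F -> w x <= M * m x.
  move=> xF; rewrite -ler_pdivrMr// /M (perm_big _ (perm_to_rem xF)) big_cons/= addrCA.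
  by rewrite lerDl addr_ge0// sumr_ge0.
have A2 : \forall i \near \oo, (\esum_(x in [set: X]) ((phi i x - u x) ^+ 2 * m x)%:E < M^-1%:E)%E.
  by apply: near_lt_of_cvg0 => //; rewrite invr_gt0.
near=> i.
have : (\esum_(x in [set: X]) ((phi i x - u x) ^+ 2 * m x)%:E < M^-1%:E)%E by near: i.
move=> /ltW; have := sum_le_esum F (fun x => (phi i x - u x) ^+ 2 * m x) uF.
move=> /(_ (fun x => mulr_ge0 (sqr_ge0 _) (ltW (m0 x)))) => /le_trans H /H.
rewrite lee_fin -[M^-1]mulr1 ler_pdivlMl// => /(le_trans _); apply.
rewrite mulr_sumr big_seq [leRHS]big_seq; apply: ler_sum => x xF.
by rewrite [leRHS](_ : _ = M * m x * (phi i x - u x) ^+ 2) ?ler_wpM2r ?sqr_ge0 ?wM//; ring.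
Unshelve. all: by end_near.
Qed.
End cutoffs.

(** * The form domain embeds into l^2(X, deg) *)

Section form_domain.
Context {R : realType} {X : countType}.
Variables (m : X -> R) (b : X -> X -> R).
Hypothesis m0 : forall x, 0 < m x.
Hypothesis gb : is_graph b.
Hypothesis lf : locally_finite b.

Lemma Cc_sub f g : Cc f -> Cc g -> Cc (f \- g : X -> R).
Proof.
move=> fC gC; apply: (@sub_finite_set _ _ ([set x | f x != 0] `|` [set x | g x != 0])).
  move=> x /=; have [->|] := eqVneq (f x) 0; last by left.
  by rewrite sub0r oppr_eq0; right.
by rewrite finite_setU.
Qed.

Lemma sqrD_le (x y : R) : (x + y) ^+ 2 <= 2 * x ^+ 2 + 2 * y ^+ 2.
Proof. by have := sqr_ge0 (x - y); lra. Qed.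

Lemma form_approx_bounded phi u : form_approx m b phi u ->
  exists B, \forall i \near \oo, forall T, uniq T ->
    \sum_(x <- T) \sum_(y <- T) b x y * (phi i x - phi i y) ^+ 2 <= B.
Proof.
move=> [phiC _ /(_ 1 ltr01) [N HN]].
(* Split phi_i = (phi_i - phi_N) + phi_N: one factor 2 comes from the square of a sum, another from
   ordered pairs, and the difference has energy below 1. *)
exists (4 + 4 * hquad m b (phi N)); exists N => // i /= Ni T uT.
have b0 := graph_ge0 gb.
have h1 := hquad_Cc m b m0 gb lf _ T (Cc_sub (phi i) (phi N) (phiC i) (phiC N)) uT.
have h2 := hquad_Cc m b m0 gb lf _ T (phiC N) uT.
have h3 := HN i N Ni (leqnn N).
apply: (@le_trans _ _ (2 * (\sum_(x <- T) \sum_(y <- T) b x y *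
    ((phi i \- phi N) x - (phi i \- phi N) y) ^+ 2) +
    2 * (\sum_(x <- T) \sum_(y <- T) b x y * (phi N x - phi N y) ^+ 2))); last lra.
rewrite !mulr_sumr -big_split; apply: ler_sum => x _ /=.
rewrite !mulr_sumr -big_split; apply: ler_sum => y _ /=.
have := sqrD_le (phi i x - phi N x - (phi i y - phi N y)) (phi N x - phi N y).
rewrite [X in X ^+ 2 <= _](_ : _ = phi i x - phi i y); last ring.
by move/(ler_wpM2l (b0 x y)); lra.
Qed.

(** Edges leaving [K] end in the fixed list [T1], so their contribution is bounded independently of
    [T], which varies with the approximating function. *)
Lemma sum_boundary_le (K T1 T : seq X) (f : X -> R) : uniq T -> uniq T1 ->
  (forall x, x \in K -> interior_vertex b T1 x) ->
  \sum_(x <- T) \sum_(y <- T) b x y * ((x \in K)%:R * f y ^+ 2) <=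
  \sum_(y <- T1) (\sum_(x <- undup K) b x y) * f y ^+ 2.
Proof.
move=> uT uT1 intK; have b0 := graph_ge0 gb.
have w0 y : 0 <= \sum_(x <- undup K) b x y by apply: sumr_ge0.
apply: (@le_trans _ _ (\sum_(y <- T) (\sum_(x <- undup K) b x y) * f y ^+ 2)).
  rewrite exchange_big; apply: ler_sum => y _ /=.
  rewrite (eq_bigr (fun x => (b x y * (x \in K)%:R) * f y ^+ 2)); last first.
    by move=> x _; rewrite mulrA.
  rewrite -mulr_suml ler_wpM2r ?sqr_ge0//.
  apply: (@le_trans _ _ (\sum_(x <- undup K) b x y * (x \in K)%:R)).
    apply: sum_le_sum_support; rewrite ?undup_uniq//.
      by move=> x; rewrite mulr_ge0.
    by move=> x _; rewrite mem_undup; case: (x \in K) => //; rewrite mulr0 eqxx.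
  by apply: ler_sum => x _; case: (x \in K); rewrite ?mulr1 ?mulr0.
apply: sum_le_sum_support => //.
  by move=> y; rewrite mulr_ge0 ?sqr_ge0.
move=> y _; apply: contraR => yT1; rewrite big1_seq ?mul0r// => x /andP[_].
rewrite mem_undup => /intK[_ HT1]; apply/eqP; apply: contraR yT1.
by move=> /(b_neq0 b gb)/HT1.
Qed.

(* The Cheeger inequality turns boundedness in the form norm into boundedness
   in l2(X, deg), which passes to the limit. *)
Lemma hbar_dom_l2_deg (K : seq X) (a : R) u : 0 < a -> hardy_off b K a ->
  hbar_dom m b u -> exists C, forall F, uniq F -> \sum_(x <- F) deg b x * u x ^+ 2 <= C.
Proof.
move=> a0 hardyK [_ [phi phiu]].
have b0 := graph_ge0 gb; have bC := graph_sym gb; have dg0 := deg_ge0 b gb lf.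
have [B HB] := form_approx_bounded phi u phiu.
have [T1 uT1 intK] := exists_interior b gb lf K.
pose w y := \sum_(x <- undup K) b x y.
have w0 y : 0 <= w y by apply: sumr_ge0.
pose C2 := 2 + 2 * \sum_(y <- T1) w y * u y ^+ 2.
(* The three summands account for the vertices in [K], for twice the squared distance between phi_i
   and [u] on [F], and for twice the Hardy bound on phi_i off [K]. *)
exists (\sum_(x <- undup K) deg b x * u x ^+ 2 + 2 + 2 * ((B + 2 * C2) / (2 * a))) => F uF.
have [i [HBi [Hw HF]]] := @filter_ex _ _ _ _ (filterI HB (filterI
  (form_approx_close m b m0 phi u T1 w phiu uT1 w0)
  (form_approx_close m b m0 phi u F (deg b) phiu uF dg0))).
have [phiC _ _] := phiu.
have [T uT intT] := exists_interior b gb lf (fset_set [set x | phi i x != 0]).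
pose psi x := if x \in K then 0 else phi i x.
have psiP x : psi x != 0 -> x \notin K /\ interior_vertex b T x.
  rewrite /psi; case: ifP => xK; first by rewrite eqxx.
  move=> px; split=> //; apply: intT.
  by rewrite in_fset_set ?mem_set//; exact: phiC.
have bdC2 : \sum_(x <- T) \sum_(y <- T) b x y * ((x \in K)%:R * phi i y ^+ 2) <= C2.
  apply: (@le_trans _ _ (\sum_(y <- T1) w y * phi i y ^+ 2)).
    exact: sum_boundary_le.
  clearbody w.
  apply: (@le_trans _ _ (2 * \sum_(x <- T1) w x * (phi i x - u x) ^+ 2 +
      2 * \sum_(y <- T1) w y * u y ^+ 2)); last by rewrite /C2; have := Hw; lra.
  rewrite !mulr_sumr -big_split; apply: ler_sum => x _ /=.
  have := sqrD_le (phi i x - u x) (u x).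
  by rewrite subrK => /(ler_wpM2l (w0 x)); lra.
have psiB : 2 * a * (\sum_(x <- T) deg b x * psi x ^+ 2) <= B + 2 * C2.
  apply: le_trans (hardyK psi T uT psiP) _.
  (* Setting phi_i to 0 on [K] affects only edges meeting [K], at the cost of the squared value at
     the other endpoint. *)
  apply: (@le_trans _ _ (\sum_(x <- T) \sum_(y <- T) b x y * (phi i x - phi i y) ^+ 2
    + (\sum_(x <- T) \sum_(y <- T) b x y * ((x \in K)%:R * phi i y ^+ 2)
    + \sum_(x <- T) \sum_(y <- T) b y x * ((y \in K)%:R * phi i x ^+ 2)))).
    rewrite -!big_split; apply: ler_sum => x _ /=.
    rewrite -!big_split; apply: ler_sum => y _ /=.
    rewrite (bC y x) -!mulrDr ler_wpM2l// /psi.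
    have := sqr_ge0 (phi i x); have := sqr_ge0 (phi i y); have := sqr_ge0 (phi i x - phi i y).
    case: (x \in K); case: (y \in K); rewrite /= ?mulr1n ?mulr0n; lra.
  rewrite -(sum_sum_sym T (fun x y => b x y * ((x \in K)%:R * phi i y ^+ 2))).
  by have := HBi T uT; lra.
have psiT : \sum_(x <- F) deg b x * psi x ^+ 2 <= (B + 2 * C2) / (2 * a).
  rewrite ler_pdivlMr ?mulr_gt0// mulrC; apply: le_trans psiB.
  rewrite ler_pM2l ?mulr_gt0//; apply: sum_le_sum_support => //.
    by move=> x; rewrite mulr_ge0 ?sqr_ge0.
  by move=> x _; have [->|/psiP[_ []]//] := eqVneq (psi x) 0; rewrite expr0n mulr0 eqxx.
apply: (@le_trans _ _ (\sum_(x <- F) deg b x * u x ^+ 2 * (x \in K)%:R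
   + 2 * \sum_(x <- F) deg b x * (phi i x - u x) ^+ 2
   + 2 * \sum_(x <- F) deg b x * psi x ^+ 2)).
  rewrite !mulr_sumr -!big_split; apply: ler_sum => x _ /=.
  rewrite /psi; case: (x \in K); rewrite ?mulr1 ?mulr0.
    by have := mulr_ge0 (dg0 x) (sqr_ge0 (phi i x - u x)); rewrite expr0n/=; lra.
  have : u x ^+ 2 <= 2 * (phi i x - u x) ^+ 2 + 2 * phi i x ^+ 2.
    by have := sqr_ge0 (u x - 2 * phi i x); lra.
  by move/(ler_wpM2l (dg0 x)); lra.
rewrite lerD ?ler_pM2l// lerD//; last by have := HF; lra.
apply: (@le_trans _ _ (\sum_(x <- undup K) deg b x * u x ^+ 2 * (x \in K)%:R)).
  apply: sum_le_sum_support; rewrite ?undup_uniq//.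
    by move=> x; rewrite mulr_ge0// mulr_ge0 ?sqr_ge0.
  by move=> x _; rewrite mem_undup; case: (x \in K) => //; rewrite mulr0 eqxx.
by apply: ler_sum => x _; case: (x \in K); rewrite ?mulr1// mulr0 mulr_ge0 ?sqr_ge0.
Qed.

Lemma degm_large : D_inf m b = +oo%E -> forall M : R,
  exists K : seq X, forall x, x \notin K -> M * m x <= deg b x.
Proof.
move=> Doo M; have : (M%:E < D_inf m b)%E by rewrite Doo ltry.
move=> /ereal_sup_gt[_ [K fK <-]] HK; exists (fset_set K) => x.
rewrite in_fset_set// notin_setE => xK.
have : (M%:E < (degm m b x)%:E)%E by apply: lt_le_trans HK _; apply: ereal_inf_lbound; exists x.
by rewrite lte_fin /degm => /ltW; rewrite ler_pdivlMr.
Qed.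

End form_domain.

(** * Exponential weights *)

(** For p <= q and z = q - p, factor out e^p and use e^z - 1 <= z e^z, which is 1 - z <= e^(-z)
    multiplied by e^z. *)
Lemma expRB_sqr_le {R : realType} (p q t : R) : `|p - q| <= t ->
  (expR p - expR q) ^+ 2 <= t ^+ 2 * expR t * expR p * expR q.
Proof.
wlog pq : p q / p <= q.
  move=> H pqt; have [/H|/ltW qp] := leP p q; first exact.
  by rewrite -sqrrN opprB mulrAC H// distrC.
rewrite distrC ger0_norm ?subr_ge0// => qt.
have t0 : 0 <= t by apply: le_trans qt; rewrite subr_ge0.
have e0 := expR_gt0 p.
have -> : expR q = expR p * expR (q - p) by rewrite -expRD addrC subrK.
have s1 := expR_ge1Dx (- (q - p)).
have s2 := expR_gt0 (q - p).
have s3 : expR (- (q - p)) * expR (q - p) = 1 by rewrite -expRD addNr expR0.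
have s4 : expR (q - p) - 1 <= (q - p) * expR (q - p).
  have := ler_wpM2r (ltW s2) s1; rewrite s3; lra.
have s5 : 0 <= expR (q - p) - 1 by rewrite subr_ge0 -expR0 ler_expR subr_ge0.
have s6 : (expR (q - p) - 1) ^+ 2 <= t ^+ 2 * expR t * expR (q - p).
  apply: (@le_trans _ _ (((q - p) * expR (q - p)) ^+ 2)).
    by rewrite ler_pXn2r ?nnegrE// mulr_ge0 ?subr_ge0// ltW.
  rewrite exprMn -mulrA ler_pM ?sqr_ge0//.
    by rewrite ler_pXn2r ?nnegrE ?subr_ge0.
  by rewrite expr2 ler_pM2r// ler_expR.
have := ler_wpM2l (sqr_ge0 (expR p)) s6; lra.
Qed.

Section graph_distance.
Context {R : realType} {X : countType}.
Variable (b : X -> X -> R).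
Hypothesis gb : is_graph b.

Lemma walk_rcons o x y n : walk b o x n -> 0 < b x y -> walk b o y n.+1.
Proof.
move=> [p [pp lp sp]] bxy; exists (rcons p y).
by rewrite rcons_path pp lp last_rcons size_rcons sp.
Qed.

Lemma gdist_adj_le o x y : 0 < b x y -> (gdist b o y <= (gdist b o x).+1)%N.
Proof.
(* Adjacent vertices are both reachable from [o] or both not, so the default distance 0 creates no
   jump along an edge. *)
move=> bxy; rewrite /gdist; case: pselect => // ey; case: pselect => ex; last first.
  exfalso; apply: ex; have [n /asboolP wn] := ey; exists n.+1; apply/asboolP.
  by apply: walk_rcons wn _; rewrite (graph_sym gb).
case: ex_minnP => k _ Hk; case: ex_minnP => l /asboolP wl _.
by apply: Hk; apply/asboolP; exact: walk_rcons wl bxy.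
Qed.

Lemma gdist_adj_diff o x y : 0 < b x y ->
  `|(gdist b o x)%:R - (gdist b o y)%:R| <= 1 :> R.
Proof.
move=> bxy; have := gdist_adj_le o x y bxy.
have := gdist_adj_le o y x; rewrite (graph_sym gb) => /(_ bxy).
rewrite -!(ler_nat R) -!natr1 ler_norml; lra.
Qed.

End graph_distance.

Section cheeger_gap.
Context {R : realType}.
Implicit Types alpha c : R.

Lemma cheeger_gap_gt0 alpha : 0 < alpha -> 0 < cheeger_gap alpha.
Proof.
move=> a0; rewrite /cheeger_gap subr_gt0 -[ltRHS](sqrtr1 R) ltr_sqrt//.
by rewrite ltrBlDr ltrDl exprn_gt0.
Qed.

Lemma cheeger_gap_le1 alpha : cheeger_gap alpha <= 1.
Proof. by rewrite /cheeger_gap lerBlDr lerDl sqrtr_ge0. Qed.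

Lemma exists_gamma alpha c : 0 <= c -> c < cheeger_gap alpha ->
  exists gamma, [/\ 0 < gamma, gamma < 1, 1 - gamma ^+ 2 < alpha ^+ 2 & c < 1 - gamma].
Proof.
rewrite /cheeger_gap => c0 cg; set s := Num.sqrt _ in cg.
have s0 : 0 <= s by exact: sqrtr_ge0.
(* The midpoint of sqrt(1 - alpha^2) and 1 - c, strictly between them by hypothesis. *)
pose gamma := (s + (1 - c)) / 2.
have sg : s < gamma by rewrite /gamma; lra.
exists gamma; split; rewrite /gamma; try lra.
rewrite -/gamma ltrBlDr -ltrBlDl.
have g0 : 0 < gamma by exact: le_lt_trans sg.
(* If alpha^2 > 1, the square root has its default value 0 and the bound holds by sign. *)
have [a1|a1] := leP 0 (1 - alpha ^+ 2).
  by rewrite -(sqr_sqrtr a1) -/s ltr_pXn2r// nnegrE// ltW.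
by apply: lt_trans a1 _; rewrite exprn_gt0.
Qed.

(** From e^(-a) <= 1/(1 + a) and a <= 1 follow r <= 1 and r <= 2 a, so r^2 <= 2 a. Since 1 - r/2 >=
    1/2, also e^(r/2) <= 2 and e^r <= 4. The left side is then at most 2 a * 5/16 < a. *)
Lemma admissible_rate_witness alpha : 0 < alpha ->
  let a := cheeger_gap alpha in admissible_rate alpha (2 * a * expR (- a)).
Proof.
move=> /cheeger_gap_gt0 a0 a; rewrite -/a in a0.
have a1 : a <= 1 := cheeger_gap_le1 alpha.
have e0 := expR_gt0 (- a); split; first by rewrite !mulr_gt0.
rewrite -/a; set e := expR (- a) in e0 *.
have e1 : e < 1 by rewrite -expR0 ltr_expR oppr_lt0.
have ea : e * (1 + a) <= 1.
  have E : e * expR a = 1 by rewrite -expRD addNr expR0.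
  by rewrite -[leRHS]E ler_pM2l// expR_ge1Dx.
have r0 : 0 < 2 * a * e by rewrite !mulr_gt0.
have r1 : 2 * a * e <= 1 by nra.
have r2a : 2 * a * e <= 2 * a by rewrite ler_piMr ?ltW// mulr_gt0.
set r := 2 * a * e in r0 r1 r2a *.
have er : expR r <= 4.
  have h0 := expR_gt0 (r / 2); have h1 := expR_ge1Dx (- (r / 2)).
  have h2 : expR (- (r / 2)) * expR (r / 2) = 1 by rewrite -expRD addNr expR0.
  have h3 : expR (r / 2) <= 2 by have := ler_wpM2r (ltW h0) h1; rewrite h2; nra.
  by rewrite [r]splitr expRD; nra.
have rr : r ^+ 2 <= 2 * a by nra.
have e5 : (1 + expR r) / 16 <= 5 / 16 by lra.
have e6 : 0 <= (1 + expR r) / 16 by rewrite divr_ge0// addr_ge0// expR_ge0.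
have := ler_pM (sqr_ge0 r) e6 rr e5; lra.
Qed.

End cheeger_gap.

Section exponential_weights.
Context {R : realType} {X : countType}.
Variables (m : X -> R) (b : X -> X -> R).
Hypothesis m0 : forall x, 0 < m x.
Hypothesis gb : is_graph b.
Hypothesis lf : locally_finite b.
Hypothesis Doo : D_inf m b = +oo%E.

Lemma hardy_off_cat K K' a : hardy_off b K a -> hardy_off b (K ++ K') a.
Proof.
move=> H psi T uT psiP; apply: H => // x /psiP[xK ?]; split=> //.
by move: xK; rewrite mem_cat negb_or => /andP[].
Qed.

(** The Agmon estimate for g = e^(s rho), whose square gives the rate 2 s. By [expRB_sqr_le] and
    delta <= 1 on edges, one may take kappa = s^2 e^s delta^2. *)
Lemma agmon_exp (u rho : X -> R) (delta : X -> X -> R) (lambda a c s : R) (K : seq X) :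
  0 <= s -> 0 <= c -> c < a -> hardy_off b K a ->
  (forall x, u x * calH m b u x <= lambda * u x ^+ 2) -> has_cutoffs b u ->
  (forall x y, 0 <= delta x y) -> (forall x y, delta x y = delta y x) ->
  (forall x y, 0 < b x y -> delta x y <= 1 /\ `|rho x - rho y| <= delta x y) ->
  (forall x T, x \notin K -> uniq T ->
     s ^+ 2 * expR s / 2 * (\sum_(y <- T) b x y * delta x y ^+ 2) <= c * deg b x) ->
  l2 (fun x => expR (2 * s * rho x) * deg b x) u.
Proof.
move=> s0 c0 ca hardyK Hu cut delta0 deltaC rho_delta HK.
have dg0 := deg_ge0 b gb lf; have b0 := graph_ge0 gb.
(* Half of the gap [t] is spent: t/4 on eps c, and t/4 on lambda m, which D_oo = oo makes small
   against deg off [K']. *)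
pose t := a - c; have t0 : 0 < t by rewrite subr_gt0.
pose eps := t / (4 * (1 + c)).
have c1 : 0 < 1 + c by rewrite ltr_pwDl.
have eps0 : 0 < eps by rewrite divr_gt0// mulr_gt0.
have epsc : eps * c <= t / 4.
  by rewrite /eps mulrAC ler_pdivrMr ?mulr_gt0//; nra.
have [K' HK'] := degm_large m b m0 Doo (4 * `|lambda| / t).
pose kappa x y := s ^+ 2 * expR s * delta x y ^+ 2.
have es0 : 0 <= s ^+ 2 * expR s by rewrite mulr_ge0 ?sqr_ge0 ?expR_ge0.
have [|||||||C HC] := agmon m b m0 gb lf u (fun x => expR (s * rho x)) lambda a (c + t / 2)
    eps (K ++ K') kappa (hardy_off_cat K K' a hardyK) Hu cut; rewrite ?/kappa.
- by move=> x; exact: expR_gt0.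
- by move=> x y; rewrite mulr_ge0 ?sqr_ge0.
- by move=> x y; rewrite deltaC.
- move=> x y /rho_delta[d1 rd].
  have sd : `|s * rho x - s * rho y| <= s * delta x y.
    by rewrite -mulrBr normrM (ger0_norm s0) ler_wpM2l.
  apply: le_trans (expRB_sqr_le _ _ _ sd) _.
  rewrite !ler_wpM2r ?expR_ge0// exprMn mulrAC ler_wpM2r ?sqr_ge0//.
  by rewrite ler_wpM2l ?sqr_ge0// ler_expR -[leRHS]mulr1 ler_wpM2l.
- exact: eps0.
- by rewrite /t; lra.
- move=> x T; rewrite mem_cat negb_or => /andP[xK xK'] uT.
  have A1 : lambda * m x <= t / 4 * deg b x.
    apply: (@le_trans _ _ (`|lambda| * m x)); first by rewrite ler_wpM2r ?ler_norm// ltW.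
    have := HK' x xK'; rewrite mulrAC ler_pdivrMr//; lra.
  have A2 := HK x T xK uT.
  rewrite (eq_bigr (fun y => s ^+ 2 * expR s * (b x y * delta x y ^+ 2))); last first.
    by move=> y _; rewrite mulrCA.
  rewrite -mulr_sumr; set S := \sum_(y <- T) _ in A2 *.
  have A3 : (1 + eps) * (s ^+ 2 * expR s / 2 * S) <= (1 + eps) * (c * deg b x).
    by rewrite ler_pM2l// addr_gt0.
  have A4 := ler_wpM2r (dg0 x) epsc.
  lra.
apply: le_lt_trans (ltry C); apply: esum_le_of_sum => r /HC; apply: le_trans.
rewrite le_eqVlt; apply/orP; left; apply/eqP; apply: eq_bigr => x _.
by rewrite expr2 [in RHS]expr2 -[in RHS]expRD; congr (_ * (expR _ * _)); ring.
Qed.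

End exponential_weights.

Theorem theorem4p6 (R : realType) (X : countType) (m : X -> R)
    (b : X -> X -> R) (lambda : R) (d : X -> X -> R) (u : X -> R) (o : X) :
  infinite_set [set: X] ->
  (forall x, 0 < m x) ->
  is_graph b ->
  locally_finite b ->
  0 < cheeger_inf b ->
  D_inf m b = +oo%E ->
  intrinsic_metric m b d ->
  jump_size b d = 1%E ->
  (calF b u /\ approximable m b u /\
     (solution m b lambda u \/ positive_subsolution m b lambda u)) \/
  (domH m b u /\ solution m b lambda u) ->
  [/\ forall rho : R, 0 < rho ->
        l2 (fun x => expR (rho * d o x) * deg b x) u,
      exists2 r : R, 0 < r &
        l2 (fun x => expR (r * (gdist b o x)%:R) * deg b x) u,
      forall r : R, admissible_rate (cheeger_inf b) r ->
        l2 (fun x => expR (r * (gdist b o x)%:R) * deg b x) u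
    & let a := cheeger_gap (cheeger_inf b) in
      admissible_rate (cheeger_inf b) (2 * a * expR (- a))].
Proof.
move=> _ m0 gb lf alpha0 Doo dI jump Hu.
have dg0 := deg_ge0 b gb lf; have b0 := graph_ge0 gb.
have hardy c : 0 <= c -> c < cheeger_gap (cheeger_inf b) ->
    exists K a, c < a /\ hardy_off b K a.
  move=> c0 /(exists_gamma _ _ c0)[gamma [g0 g1 ga cg]].
  by have [K HK] := exists_hardy_off b gb lf gamma g0 g1 alpha0 ga; exists K, (1 - gamma).
have gap0 := cheeger_gap_gt0 _ alpha0.
have usub x : u x * calH m b u x <= lambda * u x ^+ 2.
  case: Hu => [[_ [_ [sol|[u0 sub]]]]|[_ sol]].
  - by move: (sol x) => /subr0_eq ->; rewrite expr2 mulrCA.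
  - have := ler_wpM2l (u0 x) (sub x); lra.
  - by move: (sol x) => /subr0_eq ->; rewrite expr2 mulrCA.
(* In case (b) the form domain lies in l^2(X, deg), where indicators serve as cutoffs. *)
have cut : has_cutoffs b u.
  case: Hu => [[_ [app _]]|[[v [dom _ _]] _]]; first exact: (approximable_has_cutoffs m).
  have [K [a [a0 HK]]] := hardy 0 (lexx _) gap0.
  have [C HC] := hbar_dom_l2_deg m b m0 gb lf K a u a0 HK dom.
  exact: (l2_deg_has_cutoffs b gb lf u C).
have part3 r : admissible_rate (cheeger_inf b) r ->
    l2 (fun x => expR (r * (gdist b o x)%:R) * deg b x) u.
  (* The rate r corresponds to s = r/2 and delta = 1. The comparison of [c] with r^2 (1 + e^r) / 16
     is 2 e^(r/2) <= 1 + e^r. *)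
  move=> [r0 rgap]; pose c := (r / 2) ^+ 2 * expR (r / 2) / 2.
  have e0 := expR_gt0 (r / 2).
  have c0 : 0 <= c by rewrite /c divr_ge0// mulr_ge0 ?sqr_ge0// ltW.
  have cgap : c < cheeger_gap (cheeger_inf b).
    apply: le_lt_trans rgap; rewrite /c [in expR r](splitr r) expRD.
    have := ler_wpM2l (sqr_ge0 r) (sqr_ge0 (expR (r / 2) - 1)); lra.
  have [K [a [ca HK]]] := hardy c c0 cgap.
  have := @agmon_exp R X m b m0 gb lf Doo u (fun x => (gdist b o x)%:R) (fun _ _ => 1)
    lambda a c (r / 2) K (ltW _) c0 ca HK usub cut.
  rewrite (_ : 2 * (r / 2) = r); last by field.
  apply=> //; first by rewrite divr_gt0.
    by move=> x y bxy; split=> //; exact: gdist_adj_diff.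
  move=> x T _ uT; rewrite ler_wpM2l// degE//.
  under eq_bigr do rewrite expr1n mulr1.
  apply: sum_le_sum_support; rewrite ?neighbours_uniq//.
  by move=> y _ /(b_neq0 b gb); rewrite mem_neighbours.
pose a := cheeger_gap (cheeger_inf b).
have wit : admissible_rate (cheeger_inf b) (2 * a * expR (- a)).
  exact: admissible_rate_witness.
split=> //; last first.
  by exists (2 * a * expR (- a)); [case: wit|exact: part3].
move=> rho rho0.
clear a wit; have [K [a [a0 HK]]] := hardy 0 (lexx _) gap0.
pose s := rho / 2; have s0 : 0 <= s by rewrite divr_ge0// ltW.
have e0 : 0 <= s ^+ 2 * expR s / 2 by rewrite divr_ge0// mulr_ge0 ?sqr_ge0 ?expR_ge0.
(* For an intrinsic metric the sum of b d^2 is at most m, and off [K'] this threshold gives s^2 e^s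
   m / 2 <= (a/2) deg, so c = a/2 works for every rate. *)
have [K' HK'] := degm_large m b m0 Doo (s ^+ 2 * expR s / a).
have := @agmon_exp R X m b m0 gb lf Doo u (d o) d
    lambda a (a / 2) s (K ++ K') s0 _ _ (hardy_off_cat b K K' a HK) usub cut.
rewrite (_ : 2 * s = rho); last by rewrite /s; field.
apply; first by lra.
- by lra.
- exact: intrinsic_ge0 dI.
- exact: intrinsic_sym dI.
(* Jump size 1 gives d <= 1 on edges; the triangle inequality bounds the variation of d(o, .) by
   d. *)
- move=> x y bxy; split.
    rewrite -lee_fin -jump; apply: ereal_sup_ubound; exists (x, y) => //=.
  rewrite ler_norml; have := intrinsic_triangle dI o x y; have := intrinsic_triangle dI o y x.
  by rewrite (intrinsic_sym dI y x); lra.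
move=> x T; rewrite mem_cat negb_or => /andP[_ xK'] uT.
have dm : \sum_(y <- T) b x y * d x y ^+ 2 <= m x.
  rewrite -lee_fin; apply: le_trans (intrinsic_le dI x); apply: sum_le_esum => // y.
  by rewrite mulr_ge0 ?sqr_ge0.
have := HK' x xK'; rewrite mulrAC ler_pdivrMr// => A1.
have := ler_wpM2l e0 dm; lra.
Qed.
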